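(* Let $r\in(0,\infty)$ and let $\vartheta$ be a finite Borel measure on $\mathbb{R}^m$. For a fixed $\theta\in\mathcal{L}(\mathbb{R}^m)$, assuming that the quantization dimensions $D_r(\vartheta)$ and $D_r(\vartheta*\theta)$ exist, we have $$D_r(\vartheta*\theta)=D_r(\vartheta).$$
   Context: $\mathcal{L}(\mathbb{R}^m)$ is the set of measures $\sum_{i=1}^k a_i\delta_{x_i}$ with $k\in\mathbb{N}$, $x_i\in\mathbb{R}^m$, $a_i>0$, $\sum_{i=1}^k a_i=1$, where $\delta_x$ is the Dirac measure at $x$. The convolution $\vartheta*\theta$ is the push-forward of $\vartheta\times\theta$ under $(x,y)\mapsto x+y$. For a finite Borel measure $\vartheta$ on $\mathbb{R}^m$, $r\in(0,\infty)$ and $n\in\mathbb{N}$, the $n$th quantization error of order $r$ is $$V_{n,r}(\vartheta)=\inf\Big\{\int d(x,A)^r\,d\vartheta(x):A\subset\mathbb{R}^m,\ \mathrm{Card}(A)\le n\Big\},$$ with $d(x,A)$ the Euclidean distance from $x$ to $A$ ($A$ nonempty). The quantization dimension of order $r$ is $D_r(\vartheta)=\lim_{n\to\infty}\frac{r\log n}{-\log V_{n,r}(\vartheta)}$ when the limit exists; the quotient is taken to be $0$ when $V_{n,r}(\vartheta)=0$. *)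

(* Defs.v *)
From HB Require Import structures.
From mathcomp Require Import all_boot all_order all_algebra.
From mathcomp Require Import all_classical all_reals all_analysis.
Import Order.TTheory GRing.Theory Num.Theory.
Import numFieldNormedType.Exports.

Set Implicit Arguments.
Unset Strict Implicit.
Unset Printing Implicit Defensive.

Local Open Scope classical_set_scope.
Local Open Scope ring_scope.

(* R^m with its Borel sigma-algebra. The library topology on 'rV[R]_m is the
   product topology, whose open sets are those of the Euclidean distance. *)
Notation borelRV R m := (g_sigma_algebraType (@open 'rV[R]_m)).

(* The norm that the library puts on 'rV[R]_m is the sup norm, hence an
   explicit Euclidean distance. *)
Definition eucl_dist (R : realType) (m : nat) (x y : 'rV[R]_m) : R :=
  Num.sqrt (\sum_(i < m) (x ord0 i - y ord0 i) ^+ 2).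

Definition eucl_dist_set (R : realType) (m : nat) (x : 'rV[R]_m)
    (A : set 'rV[R]_m) : R :=
  inf [set eucl_dist x a | a in A].

Definition quantization_error (R : realType) (m : nat) (r : R)
    (mu : set (borelRV R m) -> \bar R) (n : nat) : \bar R :=
  ereal_inf [set (\int[mu]_x ((eucl_dist_set x A `^ r)%:E))%E |
             A in [set A : set 'rV[R]_m | A !=set0 /\ (A #<= `I_n)%card]].

(* The value is 0 when the error is 0 (convention) and when it is +oo
   (r log n divided by -oo). If the error is 1 the division by 0 yields 0;
   since finite errors tend to 0, this happens for finitely many n only. *)
Definition quantization_ratio (R : realType) (m : nat) (r : R)
    (mu : set (borelRV R m) -> \bar R) (n : nat) : R :=
  match quantization_error r mu n with
  | v%:E => if v == 0 then 0 else r * ln n%:R / (- ln v)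
  | _ => 0
  end.

(* The ratios are embedded in \bar R so that the limit may be +oo. *)
Definition quantization_dim_exists (R : realType) (m : nat) (r : R)
    (mu : set (borelRV R m) -> \bar R) : Prop :=
  cvgn (fun n => (quantization_ratio r mu n)%:E).

Definition quantization_dim (R : realType) (m : nat) (r : R)
    (mu : set (borelRV R m) -> \bar R) : \bar R :=
  limn (fun n => (quantization_ratio r mu n)%:E).

Definition convolution (R : realType) (m : nat)
    (mu nu : set (borelRV R m) -> \bar R) : set (borelRV R m) -> \bar R :=
  pushforward (mu \x nu)%E
    (fun z : borelRV R m * borelRV R m =>
       ((z.1 : 'rV[R]_m) + (z.2 : 'rV[R]_m) : borelRV R m)).

(* The class L(R^m). *)
Definition finite_dirac_mixture (R : realType) (m : nat)
    (theta : set (borelRV R m) -> \bar R) : Prop :=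
  exists (k : nat) (x : 'I_k -> borelRV R m) (a : 'I_k -> R),
    [/\ forall i, 0 < a i,
        \sum_(i < k) a i = 1 &
        forall B : set (borelRV R m), measurable B ->
          theta B = (\sum_(i < k) (a i)%:E * \d_(x i) B)%E].

(* Main.v *)
(** Write theta = sum_i a_i delta_(x_i) with k atoms, and let V_n, V'_n be the
n-th errors of vartheta and of vartheta * theta. Integrals against
vartheta * theta are averages over i of integrals against the translates of
vartheta by x_i, so V_n <= V'_n, and replacing a set A of n centers by the
union of the k sets A + x_i gives V'_(kn) <= V_n. Since v |-> 1 / (- ln v) is
nondecreasing separately on (0,1) and on (1,oo), and since V_n and V'_n
eventually lie in the same one of {0}, (0,1), {1}, (1,oo), {oo}, the ratios
satisfy u_n <= u'_n and u'_(kn) <= u_n ln(kn) / ln n for large n, and the last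
factor tends to 1. The convergence V_n -> 0 is not needed. *)

Require Import Defs.
From HB Require Import structures.
From mathcomp Require Import all_boot all_order all_algebra.
From mathcomp Require Import all_classical all_reals all_analysis.
From mathcomp Require Import measurable_realfun ring.
Import Order.TTheory GRing.Theory Num.Theory.
Import numFieldNormedType.Exports HBNNSimple.

Set Implicit Arguments.
Unset Strict Implicit.
Unset Printing Implicit Defensive.

Local Open Scope classical_set_scope.
Local Open Scope ring_scope.

(** * Translations and integrals against a convolution *)

Definition translate (R : realType) (m : nat) (c y : borelRV R m) :
    borelRV R m :=
  (y : 'rV[R]_m) + c.

Lemma measurable_translate (R : realType) (m : nat) (c : borelRV R m) :
  measurable_fun setT (translate c).
Proof.
apply: (@measurability _ _ _ (borelRV R m) _ _ (@open 'rV[R]_m) erefl).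
move=> _ [B oB <-].
rewrite setTI; apply: sub_sigma_algebra.
have trc (V : normedModType R) (d : V) : continuous (fun x => x + d).
  by move=> x; apply: cvgD; [exact: cvg_id|exact: cvg_cst].
by apply: (open_comp (f := fun x : 'rV[R]_m => x + c)) oB => x _; exact: trc.
Qed.

(** A simple integral evaluates the set function only on the measurable fibres of [h]. *)
Lemma eq_measurable_sintegral d (T : measurableType d) (R : realType)
    (mu nu : set T -> \bar R) (h : {nnsfun T >-> R}) :
  (forall B, measurable B -> mu B = nu B) -> sintegral mu h = sintegral nu h.
Proof.
move=> munu; rewrite !sintegralET; apply: eq_fsbigr => x _.
by rewrite munu.
Qed.

(* Stated for set functions, because [convolution] carries no measure
   structure. *)
Lemma eq_measurable_integral d (T : measurableType d) (R : realType)
    (mu nu : set T -> \bar R) (D : set T) (f : T -> \bar R) :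
  (forall B, measurable B -> mu B = nu B) ->
  (\int[mu]_(x in D) f x = \int[nu]_(x in D) f x)%E.
Proof.
move=> munu; rewrite /integral.
by congr (ereal_sup _ - ereal_sup _)%E; apply: eq_imagel => h _;
  exact: eq_measurable_sintegral.
Qed.

(** The product measure integrates over [y] the mass that [theta] gives to the section at [y]. This
    section is the preimage of [B] under translation by [y], so by commutativity its Dirac mass at
    [x i] is the indicator that translation by [x i] sends [y] into [B]. *)
Lemma convolution_mixtureE (R : realType) (m k : nat)
    (mu : {measure set (borelRV R m) -> \bar R})
    (theta : set (borelRV R m) -> \bar R)
    (x : 'I_k -> borelRV R m) (a : 'I_k -> R) :
    (forall i, 0 <= a i) ->
    (forall B : set (borelRV R m), measurable B ->
      theta B = (\sum_(i < k) (a i)%:E * \d_(x i) B)%E) ->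
  forall B : set (borelRV R m), measurable B ->
    convolution mu theta B =
      (\sum_(i < k) (a i)%:E * pushforward mu (translate (x i)) B)%E.
Proof.
move=> a0 thetaE B mB; rewrite /convolution /pushforward /product_measure1 /=.
have mtr c : measurable (translate c @^-1` B).
  by rewrite -[X in measurable X]setTI; apply: measurable_translate.
transitivity (\int[mu]_y
  (\sum_(i < k) (a i)%:E * (\1_(translate (x i) @^-1` B) y)%:E))%E.
  apply: eq_integral => y _ /=; rewrite thetaE; last first.
    rewrite [X in measurable X](_ : _ = translate y @^-1` B)//.
    by apply/seteqP; split=> z; rewrite /xsection /translate /= inE/= addrC.
  apply: eq_bigr => i _; congr (_ * _)%E.
  rewrite diracE indicE; congr (_%:R%:E).
  by rewrite mem_xsection.
rewrite ge0_integral_sum//=.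
- apply: eq_bigr => i _; rewrite ge0_integralZl_EFin//=.
  + by rewrite integral_indic// setIT.
  + by apply/measurable_EFinP; exact: measurable_indic.
- move=> i; apply: emeasurable_funM => //.
  by apply/measurable_EFinP; exact: measurable_indic.
- by move=> i y _; rewrite mule_ge0// lee_fin.
Qed.

(** On measurable sets the convolution agrees with a finite sum of scaled push-forwards of [mu], to
    which additivity in the measure and change of variables apply. *)
Lemma integral_convolution_mixture (R : realType) (m k : nat)
    (mu : {measure set (borelRV R m) -> \bar R})
    (theta : set (borelRV R m) -> \bar R)
    (x : 'I_k -> borelRV R m) (a : 'I_k -> R) (f : borelRV R m -> \bar R) :
    (forall i, 0 <= a i) ->
    (forall B : set (borelRV R m), measurable B ->
      theta B = (\sum_(i < k) (a i)%:E * \d_(x i) B)%E) ->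
    measurable_fun setT f -> (forall y, 0 <= f y)%E ->
  (\int[convolution mu theta]_y f y =
   \sum_(i < k) (a i)%:E * \int[mu]_y f (translate (x i) y))%E.
Proof.
(* The family [m_] below is indexed by naturals through [inord], which needs a nonempty index type;
   without atoms both sides vanish. *)
case: k x a => [|k] x a a0 thetaE mf f0.
  rewrite big_ord0 -[RHS](integral_measure_zero setT f).
  apply: eq_measurable_integral => B mB.
  by rewrite (convolution_mixtureE mu a0 thetaE)// big_ord0.
(* The measure instance of a pushforward takes the measurability proof as an
   argument, and so does [pm]. *)
pose pm c : {measure set (borelRV R m) -> \bar R} :=
  pushforward mu (translate c).
pose m_ n : {measure set (borelRV R m) -> \bar R} :=
  mscale (NngNum (a0 (inord n))) (pm (@measurable_translate R m) (x (inord n))).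
rewrite (@eq_measurable_integral _ _ _ _ (msum m_ k.+1)).
  rewrite ge0_integral_measure_sum//; apply: eq_bigr => i _.
  rewrite /m_ inord_val ge0_integral_mscale//= ge0_integral_pushforward//.
  exact: measurable_translate.
move=> B mB; rewrite (convolution_mixtureE mu a0 thetaE)//.
by apply: eq_bigr => i _; rewrite /m_ /mscale/= inord_val.
Qed.

(** * Euclidean distance to a set *)

Lemma eucl_dist_continuous (R : realType) (m : nat) (a : 'rV[R]_m) :
  continuous (fun y => eucl_dist y a).
Proof.
have cB (T : topologicalType) (f : T -> R) c :
    continuous f -> continuous (fun y => f y - c).
  by move=> cf y; apply: cvgB; [exact: cf|exact: cvg_cst].
move=> y; apply: (continuous_comp (f := fun y : 'rV[R]_m =>
  \sum_(i < m) (y ord0 i - a ord0 i) ^+ 2)); last exact: sqrt_continuous.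
apply: continuous_big => [|i _ {}y]; first exact: add_continuous.
apply: (continuous_comp (f := fun y : 'rV[R]_m => y ord0 i - a ord0 i)
  (g := fun t : R => t ^+ 2)); last exact: exprn_continuous.
by apply: cB; exact: coord_continuous.
Qed.

Lemma eucl_dist_ge0 (R : realType) (m : nat) (x y : 'rV[R]_m) :
  0 <= eucl_dist x y.
Proof. exact: sqrtr_ge0. Qed.

Lemma eucl_dist_translate (R : realType) (m : nat) (x y c : 'rV[R]_m) :
  eucl_dist (x + c) y = eucl_dist x (y - c).
Proof.
by congr Num.sqrt; apply: eq_bigr => i _; rewrite !mxE opprB addrA addrAC.
Qed.

Lemma eucl_dist_image_lbound (R : realType) (m : nat) (x : 'rV[R]_m)
    (A : set 'rV[R]_m) :
  has_lbound [set eucl_dist x a | a in A].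
Proof. by exists 0 => _ [a _ <-]; exact: eucl_dist_ge0. Qed.

(** The strict inequality makes this exact although the infimum need not be attained. *)
Lemma eucl_dist_set_lt (R : realType) (m : nat) (x : 'rV[R]_m)
    (A : set 'rV[R]_m) (t : R) : A !=set0 ->
  eucl_dist_set x A < t <-> exists2 a, A a & eucl_dist x a < t.
Proof.
move=> A0; have A0' : [set eucl_dist x a | a in A] !=set0.
  exact: image_nonempty.
split=> [/(inf_lt A0')[_ [a Aa <-] xat]|[a Aa]]; first by exists a.
by apply: le_lt_trans; apply: ge_inf; [exact: eucl_dist_image_lbound|exists a].
Qed.

Lemma eucl_dist_set_ge0 (R : realType) (m : nat) (x : 'rV[R]_m)
    (A : set 'rV[R]_m) :
  A !=set0 -> 0 <= eucl_dist_set x A.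
Proof.
by move=> A0; apply: lb_le_inf => [|_ [a _ <-]];
  [exact: image_nonempty|exact: eucl_dist_ge0].
Qed.

Lemma eucl_dist_setS (R : realType) (m : nat) (x : 'rV[R]_m)
    (A B : set 'rV[R]_m) :
  A !=set0 -> A `<=` B -> eucl_dist_set x B <= eucl_dist_set x A.
Proof.
move=> A0 AB; apply: lb_le_inf => [|_ [a Aa <-]]; first exact: image_nonempty.
by apply: ge_inf; [exact: eucl_dist_image_lbound|exists a => //; exact: AB].
Qed.

Lemma eucl_dist_set_translate (R : realType) (m : nat) (x c : 'rV[R]_m)
    (A : set 'rV[R]_m) :
  eucl_dist_set (x + c) A = eucl_dist_set x [set a - c | a in A].
Proof.
rewrite /eucl_dist_set image_comp; congr inf; apply: eq_imagel => a _.
exact: eucl_dist_translate.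
Qed.

(** The preimage of a ray []-oo, t[] is the union of the open balls of radius [t] around the points
    of [A], hence open. *)
Lemma measurable_eucl_dist_set (R : realType) (m : nat) (A : set 'rV[R]_m) :
  A !=set0 ->
  measurable_fun setT (fun y : borelRV R m => eucl_dist_set y A).
Proof.
move=> A0 mT; apply: (measurability _ (RGenInftyO.measurableE R)) => //.
move=> _ [_ [t ->] <-]; rewrite setTI.
apply: sub_sigma_algebra.
rewrite (_ : _ @^-1` _ = \bigcup_(a in A) [set y | eucl_dist y a < t]).
  apply: bigcup_open => a _.
  apply: (open_comp (f := fun y => eucl_dist y a) (D := [set s | s < t]));
    last exact: open_lt.
  by move=> y _; exact: eucl_dist_continuous.
by apply/seteqP; split => y /=; rewrite in_itv/= => /(eucl_dist_set_lt _ _ A0).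
Qed.

(** * Quantization errors of a measure and of its convolution *)

Lemma sum_weight_mule (R : realType) (k : nat) (a : 'I_k -> R) (v : \bar R) :
    (forall i, 0 < a i) -> \sum_(i < k) a i = 1 -> (0 <= v)%E ->
  (\sum_(i < k) (a i)%:E * v = v)%E.
Proof.
move=> a0 a1 v0; rewrite -ge0_sume_distrl ?sumEFin ?a1 ?mul1e// => i _.
by rewrite lee_fin ltW.
Qed.

Lemma quantization_error_ge0 (R : realType) (m : nat) (r : R)
    (mu : {measure set (borelRV R m) -> \bar R}) (n : nat) :
  (0 <= quantization_error r mu n)%E.
Proof.
apply: le_ereal_inf_tmp => _ [A _ <-]; apply: integral_ge0 => y _.
by rewrite lee_fin powR_ge0.
Qed.

Lemma quantization_error_le (R : realType) (m : nat) (r : R)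
    (mu : set (borelRV R m) -> \bar R) (n p : nat) :
  (n <= p)%N -> (quantization_error r mu p <= quantization_error r mu n)%E.
Proof.
move=> np; apply: ereal_inf_le_tmp => _ [A [A0 An] <-]; exists A => //.
by split=> //; apply: card_le_trans An _; rewrite card_le_II.
Qed.

Lemma measurable_dist_cost (R : realType) (m : nat) (r : R) (A : set 'rV[R]_m) :
  A !=set0 ->
  measurable_fun setT (fun y : borelRV R m => (eucl_dist_set y A `^ r)%:E).
Proof.
move=> A0; apply/measurable_EFinP.
apply: (measurableT_comp (f := fun t : R => t `^ r)).
  exact: measurable_powR.
exact: measurable_eucl_dist_set.
Qed.

(** The distance from [y + x i] to [A] is that from [y] to [A - x i], a set with no more points than
    [A], so every term of the average is bounded below by the error of [mu]. *)
Lemma quantization_error_convolution_ge (R : realType) (m k : nat) (r : R)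
    (mu : {measure set (borelRV R m) -> \bar R})
    (theta : set (borelRV R m) -> \bar R)
    (x : 'I_k -> borelRV R m) (a : 'I_k -> R) (n : nat) :
    (forall i, 0 < a i) -> \sum_(i < k) a i = 1 ->
    (forall B : set (borelRV R m), measurable B ->
      theta B = (\sum_(i < k) (a i)%:E * \d_(x i) B)%E) ->
  (quantization_error r mu n <=
   quantization_error r (convolution mu theta) n)%E.
Proof.
move=> a0 a1 thetaE; apply: le_ereal_inf_tmp => _ [A [A0 An] <-].
have a0' i : 0 <= a i by exact: ltW.
rewrite (integral_convolution_mixture mu a0' thetaE); last 2 first.
- exact: measurable_dist_cost.
- by move=> y; rewrite lee_fin powR_ge0.
rewrite -[leLHS](sum_weight_mule a0 a1) ?quantization_error_ge0//.
apply: lee_sum => i _; rewrite lee_pmul2l ?lte_fin//.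
apply: ereal_inf_lbound; exists [set b - x i | b in A] => /=.
  by split; [exact: image_nonempty|exact: card_le_trans (card_image_le _ _) An].
by apply: eq_integral => y _; rewrite /translate eucl_dist_set_translate.
Qed.

Lemma card_le_bigcup_image (T U : Type) (k n : nat) (A : set T)
    (f : 'I_k -> T -> U) :
  (A #<= `I_n)%card -> (\bigcup_i (f i @` A) #<= `I_(k * n))%card.
Proof.
case: k f => [|k] f; first by move=> _; rewrite bigcup0// => -[].
move=> /pfcard_geP [->|/surjfunPex[g ->]].
  by rewrite bigcup0// => i _; rewrite image_set0.
(* By division by [k.+1], the index [j] encodes a point of [A] (quotient, enumerated by [g]) and a
   map [f i] (remainder). *)
pose h j := f (inord (j %% k.+1)) (g (j %/ k.+1)%N).
apply: card_le_trans (subset_card_le _) (card_image_le h `I_(k.+1 * n)).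
move=> _ [i _] [_ [q /= qn <-] <-]; exists (q * k.+1 + i)%N => /=.
  apply: (@leq_trans (q.+1 * k.+1)); last by rewrite mulnC leq_mul2l.
  by rewrite mulSn addnC ltn_add2r.
by rewrite /h modnMDl modn_small// inord_val divnMDl// divn_small// addn0.
Qed.

(** If [B] is the union of the sets [A + x i], each [B - x i] contains [A] and is therefore at least
    as close to every point; raising to the power [r] and averaging preserve this. *)
Lemma quantization_error_convolution_le (R : realType) (m k : nat) (r : R)
    (mu : {measure set (borelRV R m) -> \bar R})
    (theta : set (borelRV R m) -> \bar R)
    (x : 'I_k -> borelRV R m) (a : 'I_k -> R) (n : nat) : 0 < r ->
    (forall i, 0 < a i) -> \sum_(i < k) a i = 1 ->
    (forall B : set (borelRV R m), measurable B ->
      theta B = (\sum_(i < k) (a i)%:E * \d_(x i) B)%E) ->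
  (quantization_error r (convolution mu theta) (k * n) <=
   quantization_error r mu n)%E.
Proof.
move=> r0 a0 a1 thetaE; apply: le_ereal_inf_tmp => _ [A [A0 An] <-].
have a0' i : 0 <= a i by exact: ltW.
pose B := \bigcup_(i : 'I_k) [set b + x i | b in A].
have subB i : A `<=` [set b - x i | b in B].
  by move=> b Ab; exists (b + x i); [exists i => //; exists b|rewrite addrK].
have B0 : B !=set0.
  (* Without atoms [B] would be empty, but the weights would then sum to 0. *)
  case: k x a a0 a1 {thetaE a0' subB} @B => [|k] x a a0 a1.
    by move: a1; rewrite big_ord0 => /esym/eqP; rewrite oner_eq0.
  by case: A0 => b Ab; exists (b + x ord0); exists ord0 => //; exists b.
apply: (@le_trans _ _ (\int[convolution mu theta]_y
    (eucl_dist_set y B `^ r)%:E)%E).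
  apply: ereal_inf_lbound; exists B => //; split=> //.
  exact: (card_le_bigcup_image (fun i b => b + x i)).
rewrite (integral_convolution_mixture mu a0' thetaE); last 2 first.
- exact: measurable_dist_cost.
- by move=> y; rewrite lee_fin powR_ge0.
set v := leRHS; have v0 : (0 <= v)%E.
  by apply: integral_ge0 => y _; rewrite lee_fin powR_ge0.
apply: (@le_trans _ _ (\sum_(i < k) (a i)%:E * v)%E); last first.
  by rewrite (sum_weight_mule a0 a1 v0).
apply: lee_sum => i _; apply: lee_wpmul2l; first by rewrite lee_fin.
rewrite /v.
apply: ge0_le_integral => //.
- by move=> y _; rewrite lee_fin powR_ge0.
- apply: (measurableT_comp (f := fun y : borelRV R m =>
    (eucl_dist_set y B `^ r)%:E)).
    exact: measurable_dist_cost.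
  exact: measurable_translate.
- exact: measurable_dist_cost.
- move=> y _; rewrite lee_fin /translate eucl_dist_set_translate.
  apply: ge0_ler_powR; rewrite ?nnegrE ?(ltW r0)//.
  + exact/eucl_dist_set_ge0/image_nonempty.
  + exact: eucl_dist_set_ge0.
  + exact: eucl_dist_setS.
Qed.

(** * Limits along [n] and [k * n] *)

Lemma cvg_ln_mul_ratio (R : realType) (k : nat) : (0 < k)%N ->
  (ln ((k * n)%N%:R : R) / ln n%:R) @[n --> \oo] --> (1 : R).
Proof.
move=> k0.
have lnoo : (ln (n%:R : R)) @[n --> \oo] --> +oo.
  apply/cvgryPge => M; near=> n.
  rewrite -[leLHS]expRK ler_ln ?posrE ?expR_gt0//.
    by near: n; exact: nbhs_infty_ger.
  by rewrite ltr0n; near: n; exact: nbhs_infty_gt.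
(* For [n > 1] the quotient equals [1 + ln k / ln n]. *)
have : (1 + ln (k%:R : R) * (ln n%:R)^-1) @[n --> \oo] -->
    (1 + ln (k%:R : R) * 0).
  apply: cvgD; first exact: cvg_cst.
  apply: cvgM; first exact: cvg_cst.
  apply/gtr0_cvgV0 => //; near=> n; rewrite ln_gt0// ltr1n; near: n.
  exact: nbhs_infty_gt.
rewrite mulr0 addr0; apply: cvg_trans; apply: near_eq_cvg; near=> n.
have n1 : (1 < n)%N by near: n; exact: nbhs_infty_gt.
rewrite natrM lnM ?posrE ?ltr0n ?(ltn_trans _ n1)// mulrDl addrC divff//.
by rewrite gt_eqF// ln_gt0// ltr1n.
Unshelve. all: by end_near.
Qed.

(** The subsequence [v (k * n)] keeps the limit of [v] and the logarithmic factor tends to 1, so the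
    two hypotheses give the two inequalities between the limits. *)
Lemma limn_interleaved (R : realType) (k : nat) (u v : nat -> R) : (0 < k)%N ->
    cvgn (fun n => (u n)%:E) -> cvgn (fun n => (v n)%:E) ->
    (\forall n \near \oo, u n <= v n) ->
    (\forall n \near \oo, v (k * n)%N <= u n * (ln ((k * n)%N%:R) / ln n%:R)) ->
  limn (fun n => (v n)%:E) = limn (fun n => (u n)%:E).
Proof.
move=> k0 cu cv uv vu; apply/eqP; rewrite eq_le; apply/andP; split; last first.
  by apply: lee_lim => //; near=> n; rewrite lee_fin; near: n.
have cvk : (v (k * n)%N)%:E @[n --> \oo] --> limn (fun n => (v n)%:E).
  exact: (cvg_comp _ _ (cvg_mulnl k k0) cv).
have cuc : ((u n)%:E * (ln ((k * n)%N%:R) / ln n%:R)%:E)%E @[n --> \oo] -->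
    limn (fun n => (u n)%:E).
  rewrite -[X in _ --> X]mule1; apply: cvgeM => //.
    (* The limit of [u] may be infinite, but its product with 1 is defined. *)
    by rewrite mule_defE onee_eq0 andbF.
  by apply: cvg_EFin; [exact: nearW|exact: cvg_ln_mul_ratio].
rewrite -(cvg_lim _ cvk)// -[leRHS](cvg_lim _ cuc)//.
apply: lee_lim; [by apply/cvg_ex; eexists; exact: cvk|
  by apply/cvg_ex; eexists; exact: cuc|].
by near=> n; rewrite -EFinM lee_fin; near: n.
Unshelve. all: by end_near.
Qed.

(** * Regimes of the error and comparison of dimensions *)

Lemma nonincreasing_nat_stationary (f : nat -> nat) :
  (forall n p, (n <= p)%N -> (f p <= f n)%N) ->
  exists N, forall n, (N <= n)%N -> f n = f N.
Proof.
move=> fle; have exf : exists v, `[< exists n, f n = v >].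
  by exists (f 0%N); apply/asboolP; exists 0%N.
case: (ex_minnP exf) => _ /asboolP[N <-] minN.
exists N => n Nn; apply/eqP; rewrite eqn_leq fle//= minN//.
by apply/asboolP; exists n.
Qed.

(* Index of the class of v >= 0 among {0}, (0,1), {1}, (1,oo), {oo}, in
   increasing order. *)
Definition error_regime (R : realType) (v : \bar R) : nat :=
  ((0 < v)%E + (1 <= v)%E + (1 < v)%E + (+oo <= v)%E)%N.

(** The factor of the ratio that depends on the error. Like the ratio, it is 0 at 0 and at [+oo]; at
    1 it is the inverse of 0, which is 0. *)
Definition inv_neg_ln (R : realType) (v : \bar R) : R :=
  match v with x%:E => if x == 0 then 0 else (- ln x)^-1 | _ => 0 end.

Lemma error_regime_le (R : realType) (v w : \bar R) :
  (v <= w)%E -> (error_regime v <= error_regime w)%N.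
Proof.
move=> vw; have le_impl (a b : bool) : (a -> b) -> (a <= b)%N.
  by case: a => // ->.
rewrite /error_regime !leq_add//; apply: le_impl => h.
- exact: lt_le_trans h vw.
- exact: le_trans h vw.
- exact: lt_le_trans h vw.
- exact: le_trans h vw.
Qed.

(** Monotonicity fails across regimes: the value is positive on (0,1) and negative on (1,oo). Inside
    either interval [- ln] decreases without changing sign, so its inverse increases; the other
    regimes are single points. *)
Lemma inv_neg_ln_le (R : realType) (v w : \bar R) :
  (0 <= v)%E -> (v <= w)%E -> error_regime v = error_regime w ->
  inv_neg_ln v <= inv_neg_ln w.
Proof.
move=> v0 vw; have w0 := le_trans v0 vw; move: v0 w0 vw.
rewrite /error_regime; case: v w => [v| |] [w| |]//=.
- rewrite !lte_fin !lee_fin => v0 w0 vw.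
  move: v0; rewrite le_eqVlt => /predU1P[v0|v0].
    rewrite -v0 ltxx ltr10 ler10 eqxx /=.
    by move: w0; rewrite le_eqVlt => /predU1P[<-|->]//; rewrite eqxx.
  have {}w0 := lt_le_trans v0 vw.
  rewrite v0 w0 !gt_eqF//.
  have lnvw : - ln w <= - ln v by rewrite lerN2 ler_ln.
  (* Of the nine cases only the three with equal regimes survive simplification. *)
  have [v1|v1|v1] := ltgtP v 1; have [w1|w1|w1] := ltgtP w 1 => //= _.
  + by rewrite lef_pV2// posrE oppr_gt0 ln_lt0// ?v0 ?w0.
  + by rewrite lef_nV2// negrE oppr_lt0 ln_gt0.
  + by rewrite v1 w1.
(* A finite [v] has regime at most 3, while [+oo] has regime 4. *)
- rewrite !ltry !leey; case: (0 < v%:E)%E; case: (1 <= v%:E)%E;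
    by case: (1 < v%:E)%E.
Qed.

Lemma quantization_ratioE (R : realType) (m : nat) (r : R)
    (mu : set (borelRV R m) -> \bar R) (n : nat) :
  quantization_ratio r mu n =
  r * ln n%:R * inv_neg_ln (quantization_error r mu n).
Proof.
rewrite /quantization_ratio /inv_neg_ln.
by case: quantization_error => [v| |]; rewrite ?mulr0//;
  case: ifP; rewrite ?mulr0.
Qed.

(** Both errors eventually stay in one common regime, where [inv_neg_ln] is monotone; the
    inequalities between errors thus become those between ratios that [limn_interleaved]
    requires. *)
Lemma quantization_dim_interleaved (R : realType) (m k : nat) (r : R)
    (mu nu : set (borelRV R m) -> \bar R) : 0 < r -> (0 < k)%N ->
  quantization_dim_exists r mu -> quantization_dim_exists r nu ->
  (forall n, 0 <= quantization_error r mu n)%E ->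
  (forall n, quantization_error r mu n <= quantization_error r nu n)%E ->
  (forall n, quantization_error r nu (k * n) <= quantization_error r mu n)%E ->
  quantization_dim r nu = quantization_dim r mu.
Proof.
move=> r0 k0 cmu cnu mu0 munu numu.
have nu0 n : (0 <= quantization_error r nu n)%E by exact: le_trans (munu n).
have [N regN] : exists N, forall n, (N <= n)%N ->
    error_regime (quantization_error r mu n) =
    error_regime (quantization_error r mu N).
  apply: nonincreasing_nat_stationary => n p np.
  exact/error_regime_le/quantization_error_le.
(* For [n >= k * N], the error of [nu] at [n] lies between that of [mu] at [n] and, through the
   index [k * N], that of [mu] at [N]; these two have the same regime. *)
have regnu n : (k * N <= n)%N -> error_regime (quantization_error r nu n) =
    error_regime (quantization_error r mu N).
  move=> kNn; have Nn : (N <= n)%N.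
    by apply: leq_trans kNn; exact: leq_pmull.
  apply/eqP; rewrite eqn_leq; apply/andP; split; last first.
    by rewrite -(regN _ Nn); exact: error_regime_le.
  apply: error_regime_le; apply: le_trans (numu N).
  exact: quantization_error_le.
apply: (limn_interleaved k0 cmu cnu); near=> n; rewrite !quantization_ratioE.
- have knN : (k * N <= n)%N by near: n; exact: nbhs_infty_ge.
  have Nn : (N <= n)%N by apply: leq_trans knN; exact: leq_pmull.
  apply: ler_wpM2l; last by apply: inv_neg_ln_le => //; rewrite regN// regnu.
  rewrite mulr_ge0 ?(ltW r0)// ln_ge0// ler1n.
  by near: n; exact: nbhs_infty_ge.
- have Nn : (N <= n)%N by near: n; exact: nbhs_infty_ge.
  have n1 : (1 < n)%N by near: n; exact: nbhs_infty_gt.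
  have ln0 : ln (n%:R : R) != 0 by rewrite gt_eqF// ln_gt0// ltr1n.
  (* The factor [ln n] of the ratio of [mu] cancels, leaving the prefactor of the ratio of [nu] at
     [k * n]. *)
  rewrite [leRHS](_ : _ = r * ln (k * n)%N%:R *
      inv_neg_ln (quantization_error r mu n)); last by field.
  apply: ler_wpM2l.
    rewrite mulr_ge0 ?(ltW r0)// ln_ge0// ler1n muln_gt0 k0.
    exact: ltnW.
  by apply: inv_neg_ln_le => //; rewrite regN// regnu// leq_mul2l Nn orbT.
Unshelve. all: by end_near.
Qed.

Theorem lemma3p10 (R : realType) (m : nat) (r : R) (hr : 0 < r)
    (vartheta : {finite_measure set (borelRV R m) -> \bar R})
    (theta : {measure set (borelRV R m) -> \bar R})
    (htheta : finite_dirac_mixture theta)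
    (hD : quantization_dim_exists r vartheta)
    (hDconv : quantization_dim_exists r (convolution vartheta theta)) :
  quantization_dim r (convolution vartheta theta) = quantization_dim r vartheta.
Proof.
case: htheta => k [x [a [a0 a1 thetaE]]].
have k0 : (0 < k)%N.
  case: k x a a0 a1 {thetaE} => // x a _ /eqP.
  by rewrite big_ord0 eq_sym oner_eq0.
apply: (quantization_dim_interleaved hr k0) => // n.
- exact: quantization_error_ge0.
- exact: quantization_error_convolution_ge a0 a1 thetaE.
- exact: quantization_error_convolution_le hr a0 a1 thetaE.
Qed.
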